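(* Let $n>1$. There are $n$ coins, each of which has one of two possible weights (real coins all weigh the same; fake coins all weigh the same and are lighter than real coins), and a balance scale on which each pan holds only one coin. Let $W(n)$ be the optimal number of weighings required to sort the coins, i.e. the minimum over all strategies of the number of weighings needed in the worst case. Then $$\left\lceil \frac{n}{2}\right\rceil \le W(n)\le n-1 .$$
   Context: The coins are labelled and look identical; the assignment of the two weights to the coins is unknown and arbitrary (in particular all coins may have the same weight), and the numerical values of the two weights are unknown. A weighing on a balance scale with tiny pans (each pan fits only one coin) compares one coin against one other coin and reports whether the two weigh the same, the left one is lighter, or the left one is heavier. A strategy is adaptive: each weighing may depend on the outcomes of the previous ones. To sort the coins means to determine the partition of the coins into groups such that coins in the same group weigh the same, coins in different groups have different weights, and for every two groups it is known which one contains the lighter coins. (If all coins weigh the same there is a single group, and one need not determine whether it is the real or the fake weight.) A strategy sorts the coins in $m$ weighings if, for every possible assignment of weights, it uses at most $m$ weighings and its outcomes determine the sorting. *)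

(* Defs.v *)
From mathcomp Require Import all_boot all_order all_algebra.
From mathcomp Require Import boolp.

Set Implicit Arguments.
Unset Strict Implicit.
Unset Printing Implicit Defensive.

Import Order.TTheory GRing.Theory Num.Theory.
Local Open Scope ring_scope.

(* The two weights belong to the unknown assignment, not to the strategy.
   [fakes] is arbitrary: it may be empty or contain every coin. *)
Record assignment (R : realFieldType) (n : nat) := Assignment {
  fake_weight : R;
  real_weight : R;
  fakes : {set 'I_n};
  fake_weight_gt0 : 0 < fake_weight;
  fake_lt_real : fake_weight < real_weight
}.

Definition weight (R : realFieldType) (n : nat) (a : assignment R n)
    (i : 'I_n) : R :=
  if i \in fakes a then fake_weight a else real_weight a.

Inductive outcome := Balanced | LeftLighter | LeftHeavier.

Definition weigh (R : realFieldType) (n : nat) (a : assignment R n)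
    (i j : 'I_n) : outcome :=
  if weight a i < weight a j then LeftLighter
  else if weight a j < weight a i then LeftHeavier
  else Balanced.

Inductive strategy (n : nat) :=
  | Stop
  | Weigh (i j : 'I_n) of i != j & (outcome -> strategy n).

Arguments Stop {n}.

Fixpoint outcomes (R : realFieldType) (n : nat) (S : strategy n)
    (a : assignment R n) : seq outcome :=
  match S with
  | Stop => [::]
  | Weigh i j _ next => weigh a i j :: outcomes (next (weigh a i j)) a
  end.

Definition groups (R : realFieldType) (n : nat) (a : assignment R n) :
    {set {set 'I_n}} :=
  preim_partition (weight a) [set: 'I_n].

Definition lighter (R : realFieldType) (n : nat) (a : assignment R n) :
    rel {set 'I_n} :=
  fun A B => [forall i in A, forall j in B, weight a i < weight a j].

Definition same_sorting (R : realFieldType) (n : nat) (a b : assignment R n) :=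
  groups a = groups b /\ {in groups a &, lighter a =2 lighter b}.

(* The outcomes determine the sorting when assignments, possibly with different
   numerical weights, that produce the same outcomes have the same sorting. *)
Definition sorts_in (R : realFieldType) (n : nat) (S : strategy n) (m : nat) :=
  (forall a : assignment R n, (size (outcomes S a) <= m)%N) /\
  (forall a b : assignment R n,
      outcomes S a = outcomes S b -> same_sorting a b).

Definition sortable_in (R : realFieldType) (n m : nat) : Prop :=
  exists S : strategy n, sorts_in R S m.

(* Weighing every pair sorts the coins, so the minimum in [W] exists. *)
Section Existence.
Variables (R : realFieldType) (n : nat).

Fixpoint weigh_all (s : seq {p : 'I_n * 'I_n | p.1 != p.2}) : strategy n :=
  if s is p :: s' then Weigh (valP p) (fun=> weigh_all s') else Stop.

Lemma outcomes_weigh_all s (a : assignment R n) :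
  outcomes (weigh_all s) a = [seq weigh a (val p).1 (val p).2 | p <- s].
Proof. by elim: s => //= p s ->. Qed.

Lemma weigh_same_sorting (a b : assignment R n) :
  (forall i j, weigh a i j = weigh b i j) -> same_sorting a b.
Proof.
move=> eq_ab.
have ltE i j : (weight a i < weight a j) = (weight b i < weight b j).
  move: (eq_ab i j); rewrite /weigh.
  by case: ltgtP => _; case: ltgtP.
have eqE i j : (weight a i == weight a j) = (weight b i == weight b j).
  by rewrite !eq_le !leNgt !ltE.
split.
  rewrite /groups /preim_partition /equivalence_partition.
  by apply: eq_imset => i; apply/setP => j; rewrite !inE /= eqE.
move=> A B _ _; rewrite /lighter.
by apply: eq_forallb => i; congr (_ ==> _); apply: eq_forallb => j; rewrite ltE.
Qed.

Lemma sortable : exists m, `[< sortable_in R n m >].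
Proof.
set s := enum {: {p : 'I_n * 'I_n | p.1 != p.2}}.
exists (size s); apply/asboolP; exists (weigh_all s); split=> [a|a b].
  by rewrite outcomes_weigh_all size_map.
rewrite !outcomes_weigh_all => /eq_in_map eq_s.
apply: weigh_same_sorting => i j.
have [<-|ne_ij] := eqVneq i j; first by rewrite /weigh !ltxx.
exact: (eq_s (Sub (i, j) ne_ij) (mem_enum _ _)).
Qed.

End Existence.

Definition W (R : realFieldType) (n : nat) : nat := ex_minn (sortable R n).

(* Main.v *)
(** Lower bound: if all coins are real and some coin is never weighed, making
    that coin fake changes the sorting but not the outcomes; hence all [n] coins
    are weighed, and each weighing involves only two of them.  Upper bound: as
    there are only two weights, comparing one coin to each of the others
    determines the outcomes of all other weighings. *)

Require Import Defs.
From mathcomp Require Import all_boot all_order all_algebra.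
From mathcomp Require Import boolp.

Set Implicit Arguments.
Unset Strict Implicit.
Unset Printing Implicit Defensive.

Import Order.TTheory GRing.Theory Num.Theory.

(** The numerical weights drop out, which reduces comparisons of outcomes to Boolean case
    analysis. *)
Lemma weighE (R : realFieldType) (n : nat) (a : assignment R n) (i j : 'I_n) :
  weigh a i j = if (i \in fakes a) == (j \in fakes a) then Balanced
                else if i \in fakes a then LeftLighter else LeftHeavier.
Proof.
rewrite /weigh /weight; have lt_fr := fake_lt_real a.
by case: (i \in _); case: (j \in _); rewrite /= ?ltxx ?lt_fr ?(lt_gtF lt_fr).
Qed.

(** An imbalance against [k] reveals the kind of [k], hence that of every coin. If [k] balances with
    all coins, they all weigh the same, and every weighing balances under both assignments. *)
Lemma weigh_from (R : realFieldType) (n : nat) (a b : assignment R n)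
    (k : 'I_n) :
  (forall i, weigh a k i = weigh b k i) ->
  forall i j, weigh a i j = weigh b i j.
Proof.
move=> eq_k i j; move: (eq_k i) (eq_k j); rewrite !weighE.
(* The six truth values say whether each of [i], [j], [k] is fake under [a] and under [b]. *)
by do 6!case: (_ \in _).
Qed.

Lemma sortable_pred (R : realFieldType) (n : nat) : sortable_in R n n.-1.
Proof.
case: n => [|n].
  exists Stop; split=> // a b _.
  by apply: weigh_same_sorting => -[].
pose pair0 (i : 'I_n) : {p : 'I_n.+1 * 'I_n.+1 | p.1 != p.2} :=
  Sub (ord0, lift ord0 i) (neq_lift ord0 i).
exists (weigh_all [seq pair0 i | i <- enum 'I_n]); split=> [a|a b].
  by rewrite outcomes_weigh_all 2!size_map size_enum_ord.
rewrite !outcomes_weigh_all -!(map_comp _ pair0) => /eq_in_map eq_ab.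
apply: weigh_same_sorting; apply: (weigh_from (k := ord0)) => i.
case: (unliftP ord0 i) => [j|] ->; last by rewrite !weighE !eqxx.
exact: eq_ab (mem_enum _ j).
Qed.

Fixpoint weighed (R : realFieldType) (n : nat) (S : strategy n)
    (a : assignment R n) : {set 'I_n} :=
  match S with
  | Stop => set0
  | Weigh i j _ next => [set i; j] :|: weighed (next (weigh a i j)) a
  end.

Lemma card_weighed (R : realFieldType) (n : nat) (S : strategy n)
    (a : assignment R n) :
  #|weighed S a| <= (size (outcomes S a)).*2.
Proof.
elim: S => [|i j ne_ij next IH] /=; first by rewrite cards0.
rewrite doubleS -add2n; apply: leq_trans (leq_card_setU _ _) _.
by rewrite cards2 ne_ij leq_add2l.
Qed.

(** Following the run on [a] alone suffices: agreement on the two coins being weighed sends [b] into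
    the same branch. *)
Lemma eq_outcomes (R : realFieldType) (n : nat) (S : strategy n)
    (a b : assignment R n) :
  {in weighed S a, fakes a =i fakes b} -> outcomes S a = outcomes S b.
Proof.
elim: S => [//|i j ne_ij next IH] /= eq_ab.
have eq_w : weigh a i j = weigh b i j.
  by rewrite !weighE !eq_ab ?inE ?eqxx ?orbT.
by rewrite -eq_w IH // => k k_in; rewrite eq_ab // inE k_in orbT.
Qed.

Lemma same_sorting_eq_weight (R : realFieldType) (n : nat)
    (a b : assignment R n) (i j : 'I_n) :
  same_sorting a b -> (weight a i == weight a j) = (weight b i == weight b j).
Proof.
case=> eq_groups _.
(* Equality of weights can be read off the partition: it is membership in the block of [i]. *)
have groupE (c : assignment R n) :
    (j \in pblock (groups c) i) = (weight c i == weight c j).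
  rewrite pblock_equivalence_partition ?inE // => x y z _ _ _.
  by split=> // /eqP ->.
by rewrite -!groupE eq_groups.
Qed.

Lemma weighed_all (R : realFieldType) (n : nat) (S : strategy n)
    (a : assignment R n) :
  1 < n -> (forall b, outcomes S a = outcomes S b -> same_sorting a b) ->
  fakes a = set0 -> weighed S a = setT.
Proof.
move=> n_gt1 S_sorts a0; apply/setP => i; rewrite inE.
apply/negPn/negP => iNw.
pose b := Assignment [set i] (fake_weight_gt0 a) (fake_lt_real a).
have /S_sorts sab : outcomes S a = outcomes S b.
  apply: eq_outcomes => j j_in; rewrite a0 !inE.
  by apply/esym/negbTE; apply: contraNneq iNw => <-.
(* A second coin, available since [1 < n], witnesses the change: it weighs the same as [i] under [a]
   but not under [b]. *)
have [j neq_ji] : exists j, j != i.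
  have /card_gt0P[j] : 0 < #|[set~ i]| by rewrite cardsC1 card_ord -subn1 subn_gt0.
  by rewrite !inE => neq_ji; exists j.
have := same_sorting_eq_weight i j sab.
by rewrite /weight a0 !inE eqxx (negbTE neq_ji) eqxx /= (lt_eqF (fake_lt_real a)).
Qed.

Lemma sortable_in_ge (R : realFieldType) (n m : nat) :
  1 < n -> sortable_in R n m -> uphalf n <= m.
Proof.
move=> n_gt1 [S [S_size S_sorts]].
(* Any two weights would do; 1 and 2 give a concrete assignment with all coins real. *)
have lt12 : (1 < 2 :> R)%R by rewrite ltr1n.
pose a := Assignment (set0 : {set 'I_n}) (ltr01 : (0 < 1 :> R)%R) lt12.
rewrite leq_uphalf_double; apply: leq_trans (_ : (size (outcomes S a)).*2 <= _).
  have := card_weighed S a.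
  by rewrite (weighed_all n_gt1 (S_sorts a)) // cardsT card_ord.
by rewrite leq_double.
Qed.

Theorem theorem3p1 (R : realFieldType) (n : nat) (hn : 1 < n) :
  uphalf n <= W R n <= n - 1.
Proof.
rewrite /W; case: ex_minnP => m /asboolP m_sorts m_min.
rewrite (sortable_in_ge hn m_sorts) subn1.
by apply: m_min; apply/asboolP; apply: sortable_pred.
Qed.
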